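(* Let $(k_n)_{n\ge 1}$ be positive integers with $k_n\to\infty$ as $n\to\infty$, and let $\{\xi_{n,j} : 1\le j\le k_n,\ n\ge 1\}$ be a triangular array of real random variables on a probability space $(X,\mathscr{B},P)$ such that, for each $n\ge 1$, the random variables $\xi_{n,1},\dots,\xi_{n,k_n}$ are independent, and $E\xi_{n,j}=0$, $E\xi_{n,j}^2<\infty$ for all $1\le j\le k_n$, $n\ge 1$. Put $S_n=\sum_{j=1}^{k_n}\xi_{n,j}$ and let $DS_n$ denote the variance of $S_n$, with $DS_n>0$ for all $n\ge 1$. Suppose that the Lindeberg condition holds: for every $\varepsilon>0$, $$\frac{1}{DS_n}\sum_{j=1}^{k_n}\int_{\{|\xi_{n,j}|>\varepsilon\sqrt{DS_n}\}}\xi_{n,j}^2\,dP\to 0\quad\text{as } n\to\infty .$$ Then the family of squares of normed row sums $\{S_n^2/DS_n : n\ge 1\}$ is uniformly integrable.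
   Context: A family of random variables $\{\eta_n : n\ge 1\}$ is uniformly integrable if $\sup_{n}\int_{\{|\eta_n|>C\}}|\eta_n|\,dP\to 0$ as $C\to\infty$. Independence is required only within each row $n$ of the array; no independence between different rows is assumed. *)

(* Defs.v *)
From HB Require Import structures.
From mathcomp Require Import all_boot all_order all_algebra.
From mathcomp Require Import all_classical all_reals all_analysis.

Set Implicit Arguments.
Unset Strict Implicit.
Unset Printing Implicit Defensive.

Import Order.TTheory GRing.Theory Num.Theory.
Import numFieldNormedType.Exports.

Local Open Scope classical_set_scope.
Local Open Scope ring_scope.
Local Open Scope ereal_scope.

Definition mutually_independent (d : measure_display) (T : measurableType d)
    (R : realType) (P : probability T R) (I : finType)
    (X : I -> {RV P >-> R}) : Prop :=
  forall (J : {set I}) (B : I -> set R), (forall i, measurable (B i)) ->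
    P (\bigcap_(i in [set` J]) (X i @^-1` B i)) =
    \prod_(i in J) P (X i @^-1` B i).

(* [D] is the index set of the family; it must be nonempty, since
   [ereal_sup set0] is [-oo]. *)
Definition uniformly_integrable (d : measure_display) (T : measurableType d)
    (R : realType) (P : probability T R) (I : Type) (D : set I)
    (eta : I -> T -> R) : Prop :=
  (fun C : R => ereal_sup
     [set \int[P]_(w in [set w | (C < `|eta n w|)%R]) (`|eta n w|)%:E | n in D])
    @ +oo%R --> 0.

Definition row_sum (d : measure_display) (T : measurableType d)
    (R : realType) (P : probability T R) (k : nat -> nat)
    (xi : forall n, 'I_(k n) -> {RV P >-> R}) (n : nat) : T -> R :=
  fun w => (\sum_(j < k n) xi n j w)%R.

(* The library's variance is extended-real valued; [fine] loses nothing for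
   square-integrable rows, whose sums have finite variance. *)
Definition row_var (d : measure_display) (T : measurableType d)
    (R : realType) (P : probability T R) (k : nat -> nat)
    (xi : forall n, 'I_(k n) -> {RV P >-> R}) (n : nat) : R :=
  fine 'V_P[row_sum xi n].

Definition lindeberg (d : measure_display) (T : measurableType d)
    (R : realType) (P : probability T R) (k : nat -> nat)
    (xi : forall n, 'I_(k n) -> {RV P >-> R}) : Prop :=
  forall eps : R, (0 < eps)%R ->
    ((row_var xi n)^-1)%:E *
      (\sum_(j < k n)
        \int[P]_(w in [set w | (eps * Num.sqrt (row_var xi n) < `|xi n j w|)%R])
          ((xi n j w) ^+ 2)%:E) @[n --> \oo] --> 0.

(* Main.v *)
Require Import Defs.
From HB Require Import structures.
From mathcomp Require Import all_boot all_order all_algebra.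
From mathcomp Require Import finmap.
From mathcomp Require Import all_classical all_reals all_analysis.
From mathcomp Require Import measurable_realfun.
From mathcomp Require Import ring lra.
Import Order.TTheory GRing.Theory Num.Theory.
Import numFieldNormedType.Exports.
Import HBNNSimple.
Local Open Scope classical_set_scope.
Local Open Scope ring_scope.

Set Implicit Arguments.
Unset Strict Implicit.

(** Fix a row with sum [S], variance [v] and standard deviation [s].  Cut every
    variable at the level [s], replacing [x] by [trunc s x], and centre both the
    bounded part and the remainder; since the variables have mean zero, this
    writes [S = A + B] with [A] and [B] sums of independent centred variables.

    - The remainder is small in L2: by orthogonality the second moment of [B] is
      at most the sum of the integrals of the squares over the sets where a
      variable exceeds [s], so that of [B / s] is at most the Lindeberg sum with
      epsilon equal to 1.
    - The bounded part has an exponential moment controlled by nothing but the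
      variance.  Each centred truncated variable is at most [2 s] in absolute
      value, and [expR y <= 1 + y + 2 y^2] for [y <= 1/2]; multiplying the
      resulting bounds over the row gives that both expectations of
      [expR (+- A / (4 s))] are at most [expR (1/8) <= 2].

    If [C < (a + b)^2], then either [b] dominates and [(a + b)^2 <= 4 b^2], or
    [a] dominates and [(a + b)^2 <= 16 a^4 / C] ([sqrD_le_split]).  As [a^4] is
    dominated by the two exponentials, the tail integral of [S^2 / v] beyond [C]
    is at most a universal constant over [C] plus four times the Lindeberg sum
    ([integral_tail_sqr_sum_indep]).  Given a tolerance, the Lindeberg condition
    handles all rows from some index on, uniformly for large [C]; each of the
    finitely many remaining rows has an integrable square, whose tail vanishes
    by itself ([integrable_tail_near]).

    Independence enters only through the multiplicativity of expectations of
    nonnegative functions of the variables ([integral_prod_indep]), which yields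
    both the orthogonality and the exponential moments. *)

(** * Independence and expectations of products *)

(** The two sides, as functionals of [f], are linear and continuous along
    monotone limits, so agreement on indicators extends to nonnegative simple
    functions and then to nonnegative measurable functions.  Finiteness of [c]
    makes multiplication by [c] continuous on extended reals. *)
Lemma ge0_integral_comp_extend (d d' : measure_display)
    (T : measurableType d) (U : measurableType d') (R : realType)
    (mu : {measure set T -> \bar R}) (G : T -> R) (X : T -> U) (c : \bar R) :
  c \is a fin_num ->
  measurable_fun setT G -> (forall w, 0 <= G w) -> measurable_fun setT X ->
  (forall B : set U, measurable B ->
    (\int[mu]_w (G w * \1_B (X w))%:E = c * \int[mu]_w (\1_B (X w))%:E)%E) ->
  forall f : U -> R, measurable_fun setT f -> (forall x, 0 <= f x) ->
    (\int[mu]_w (G w * f (X w))%:E = c * \int[mu]_w (f (X w))%:E)%E.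
Proof.
move=> cfin mG G0 mX indX f mf f0.
have mf' : measurable_fun setT (EFin \o f) by exact/measurable_EFinP.
pose h := nnsfun_approx measurableT mf'.
have h0 n x : 0 <= h n x by exact: fun_ge0.
have mhX n : measurable_fun setT (fun w => h n (X w)).
  exact: (measurableT_comp (@measurable_funPT _ _ _ _ (h n)) mX).
have hnd x m n : (m <= n)%N -> h m x <= h n x.
  by move=> mn; have /lefP := nd_nnsfun_approx measurableT mf' mn; exact.
have hcvg x : (h n x)%:E @[n --> \oo] --> (f x)%:E.
  by apply: (cvg_nnsfun_approx measurableT mf') => // y _; rewrite lee_fin.
have m1 y n : measurable_fun setT (fun w => \1_(h n @^-1` [set y]) (X w) : R).
  apply: (measurableT_comp _ mX); apply: measurable_indic.
  exact: (measurable_funPTI (h n)).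
have hE n : (\int[mu]_w (G w * h n (X w))%:E = c * \int[mu]_w (h n (X w))%:E)%E.
  pose s : seq R := fset_set (range (h n)).
  pose A i := h n @^-1` [set s`_i].
  have hs x : h n x = \sum_(i < size s) s`_i * \1_(A i) x.
    exact: fimfunEord.
  have s0 (i : 'I_(size s)) : 0 <= s`_i.
    have : s`_i \in s by rewrite mem_nth.
    by rewrite /s in_fset_set// => /set_mem [x _ <-].
  have mA i : measurable_fun setT (fun w => \1_(A i) (X w) : R) by exact: m1.
  have mGA i : measurable_fun setT (fun w => G w * \1_(A i) (X w)).
    exact: (measurable_funM mG (mA i)).
  have one0 i w : 0 <= \1_(A i) (X w) :> R by [].
  transitivity (\sum_(i < size s)
      (s`_i)%:E * \int[mu]_w (G w * \1_(A i) (X w))%:E)%E.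
    under eq_integral => w _.
      rewrite hs mulr_sumr -sumEFin.
      under eq_bigr do rewrite mulrCA EFinM.
      over.
    rewrite ge0_integral_sum//; last 2 first.
    - move=> i; apply: measurable_funeM; exact/measurable_EFinP.
    - by move=> i w _; rewrite -EFinM lee_fin !mulr_ge0.
    apply: eq_bigr => i _; rewrite ge0_integralZl_EFin//.
    - by move=> w _; rewrite lee_fin mulr_ge0.
    - exact/measurable_EFinP.
  transitivity (\sum_(i < size s)
      c * ((s`_i)%:E * \int[mu]_w (\1_(A i) (X w))%:E))%E.
    apply: eq_bigr => i _; rewrite indX 1?muleCA//.
    exact: (measurable_funPTI (h n)).
  rewrite -ge0_sume_distrr//; last first.
    by move=> i _; apply: mule_ge0; [rewrite lee_fin|apply: integral_ge0].
  congr (_ * _)%E.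
  under [in RHS]eq_integral => w _ do rewrite hs -sumEFin.
  rewrite ge0_integral_sum//; last 2 first.
  - move=> i; apply/measurable_EFinP; apply: measurable_funM (mA i).
    exact: measurable_cst.
  - by move=> i w _; rewrite lee_fin mulr_ge0.
  apply: eq_bigr => i _; rewrite -ge0_integralZl_EFin//.
  exact/measurable_EFinP.
have mono (g : T -> R) : measurable_fun setT g -> (forall w, 0 <= g w) ->
    (\int[mu]_w (g w * h n (X w))%:E @[n --> \oo]
       --> \int[mu]_w (g w * f (X w))%:E)%E.
  move=> mg g0.
  have gcvg w : (g w * h n (X w))%:E @[n --> \oo] --> (g w * f (X w))%:E.
    by under eq_fun do rewrite EFinM; rewrite EFinM; exact: cvgeZl.
  under eq_integral => w _ do rewrite -(cvg_lim _ (gcvg w))//.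
  apply: cvg_monotone_convergence => //.
  - by move=> n; apply/measurable_EFinP; exact: (measurable_funM mg (mhX n)).
  - by move=> n w _; rewrite lee_fin mulr_ge0.
  - by move=> w _ m n mn; rewrite lee_fin ler_wpM2l// hnd.
(* The integrals of [G w * h n (X w)] converge to the left-hand side by [mono];
   by [hE] they are [c] times those of [h n (X w)], which converge to the
   integral on the right-hand side by [mono] with weight 1. *)
have := mono (cst 1) (measurable_cst _) (fun=> ler01).
have mul1 (u : T -> R) : (fun w => (cst 1 w * u w)%:E) = (EFin \o u).
  by apply/funext => w /=; rewrite mul1r.
rewrite mul1; under eq_fun do rewrite mul1.
move=> /(cvgeZl cfin).
under eq_fun do rewrite -hE.
by move=> cvgc; exact: (cvg_unique _ (mono G mG G0) cvgc).
Qed.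

(** The hypothesis is the case of indicators.  Indicators are replaced by the
    given functions one index at a time: with the other factors fixed, both
    sides depend on the factor at that index as in [ge0_integral_comp_extend].
*)
Lemma integral_prod_indep (d : measure_display) (T : measurableType d)
    (R : realType) (P : probability T R) (I : finType)
    (X : I -> {RV P >-> R}) (f : I -> R -> R) :
  mutually_independent X ->
  (forall i, measurable_fun setT (f i)) -> (forall i x, 0 <= f i x) ->
  (forall i, \int[P]_w (f i (X i w))%:E < +oo)%E ->
  (\int[P]_w (\prod_i f i (X i w))%:E = \prod_i \int[P]_w (f i (X i w))%:E)%E.
Proof.
move=> indX mf f0 foo.
(* [s] lists the indices whose factor is no longer assumed to be an indicator. *)
suff gen (s : seq I) : forall g : I -> R -> R,
    (forall i, measurable_fun setT (g i)) -> (forall i x, 0 <= g i x) ->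
    (forall i, \int[P]_w (g i (X i w))%:E < +oo)%E ->
    (forall i, i \notin s ->
       exists B : set R, measurable B /\ g i = (\1_B : R -> R)) ->
    (\int[P]_w (\prod_i g i (X i w))%:E = \prod_i \int[P]_w (g i (X i w))%:E)%E.
  apply: (gen (enum I)) => // i.
  by rewrite mem_enum.
elim: s => [|a s IHs] g mg g0 goo gB.
  have {}gB i : exists B : set R, measurable B /\ g i = (\1_B : R -> R).
    exact: gB.
  have /choice [B /all_and2 [mB gE]] := gB.
  under eq_integral => w _ do under eq_bigr do rewrite gE.
  have -> : (\prod_i \int[P]_w (g i (X i w))%:E =
             \prod_(i in [set: I]%SET) P (X i @^-1` B i))%E.
    apply: eq_big => [i|i _]; first by rewrite inE.
    under eq_integral do rewrite gE.
    have mXB := measurable_funPTI (X i) (mB i).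
    by rewrite (integral_indic P measurableT mXB) setIT.
  rewrite -indX// -[in RHS](setIT (\bigcap_(i in _) _)) -integral_indic//.
    apply: eq_integral => w _; congr EFin.
    rewrite indicE; case: (boolP (w \in _)) => [/set_mem wB|/negP wB] /=.
      rewrite big1// => i _.
      by rewrite indicE mem_set//; apply: wB; rewrite /= inE.
    have [i wBi] : exists i, ~ B i (X i w).
      apply: contra_notP wB => /forallNP wB; apply/mem_set => i _ /=.
      by apply: contrapT; exact: wB.
    by rewrite (bigD1 i)//= indicE memNset ?mul0r.
  by apply: fin_bigcap_measurable => // i _; exact: measurable_funPTI.
pose G w := \prod_(i | i != a) g i (X i w).
pose c := (\prod_(i | i != a) \int[P]_w (g i (X i w))%:E)%E.
have int0 (h : R -> R) i :
    (forall x, 0 <= h x) -> (0 <= \int[P]_w (h (X i w))%:E)%E.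
  by move=> h0; apply: integral_ge0 => w _; rewrite lee_fin.
have -> : (\prod_i \int[P]_w (g i (X i w))%:E =
           c * \int[P]_w (g a (X a w))%:E)%E.
  by rewrite (bigD1 a)//= muleC.
under eq_integral => w _ do rewrite (bigD1 a)//= mulrC -/(G w).
have mX i : measurable_fun setT (X i) by exact: measurable_funPT.
apply: (ge0_integral_comp_extend _ _ _ (mX a)) => //.
- apply: prode_fin_num => i _; rewrite ge0_fin_numE; first exact: goo.
  exact: int0.
- rewrite /G; under eq_fun do rewrite -big_filter.
  by apply: measurable_prod => i _; exact: (measurableT_comp (mg i)).
- by move=> w; apply: prodr_ge0.
move=> B mB.
pose h i : R -> R := if i == a then \1_B else g i.
have ha : h a = \1_B by rewrite /h eqxx.
have hE i : i != a -> h i = g i by rewrite /h => /negbTE ->.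
have -> : c = (\prod_(i | i != a) \int[P]_w (h i (X i w))%:E)%E.
  by apply: eq_bigr => i ia; rewrite hE.
rewrite -ha [RHS]muleC.
have <- := bigD1 a (P := xpredT) (F := fun i => \int[P]_w (h i (X i w))%:E)%E isT.
rewrite -IHs.
- apply: eq_integral => w _; rewrite [in RHS](bigD1 a)//= mulrC; congr (_ * _)%:E.
  by apply: eq_bigr => i ia; rewrite hE.
- by move=> i; rewrite /h; case: ifP.
- by move=> i x; rewrite /h; case: ifP.
- move=> i; rewrite /h; case: ifP => // _.
  have mXB := measurable_funPTI (X i) mB.
  rewrite (integral_indic P measurableT mXB) setIT.
  by rewrite (le_lt_trans (probability_le1 P mXB))// ltry.
- move=> i i_s; rewrite /h; case: (eqVneq i a) => [_|ia]; first by exists B.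
  by apply: gB; rewrite inE negb_or ia.
Qed.

(** * Orthogonality in L2 *)

Lemma Lfun2_intro (d : measure_display) (T : measurableType d) (R : realType)
    (mu : {measure set T -> \bar R}) (Y : T -> R) :
  measurable_fun setT Y -> (\int[mu]_w ((Y w) ^+ 2)%:E < +oo)%E ->
  Y \in Lfun mu 2%:E.
Proof.
move=> mY Yoo; rewrite inE/=; apply/andP; split; rewrite inE//=.
rewrite /finite_norm unlock poweR_lty//.
under eq_integral => w _ do
  rewrite /= powR_mulrn// real_normK ?num_real//.
by [].
Qed.

Lemma sqr_le_norm (R : realDomainType) (x y : R) :
  `|x| <= `|y| -> x ^+ 2 <= y ^+ 2.
Proof.
move=> xy; rewrite -[leLHS]real_normK ?num_real// -[leRHS]real_normK ?num_real//.
by rewrite ler_sqr ?nnegrE.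
Qed.

Lemma integral_sqr_le (d : measure_display) (T : measurableType d)
    (R : realType) (mu : {measure set T -> \bar R}) (Y Z : T -> R) :
  measurable_fun setT Y -> measurable_fun setT Z ->
  (forall w, `|Y w| <= `|Z w|) ->
  (\int[mu]_w ((Y w) ^+ 2)%:E <= \int[mu]_w ((Z w) ^+ 2)%:E)%E.
Proof.
move=> mY mZ YZ; apply: ge0_le_integral => //.
- by move=> w _; rewrite lee_fin sqr_ge0.
- by apply/measurable_EFinP; exact: measurable_funX.
- by apply/measurable_EFinP; exact: measurable_funX.
- by move=> w _; rewrite lee_fin sqr_le_norm.
Qed.

Lemma Lfun2_le (d : measure_display) (T : measurableType d) (R : realType)
    (mu : {measure set T -> \bar R}) (Y Z : T -> R) :
  measurable_fun setT Y -> measurable_fun setT Z -> Z \in Lfun mu 2%:E ->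
  (forall w, `|Y w| <= `|Z w|) -> Y \in Lfun mu 2%:E.
Proof.
move=> mY mZ Z2 YZ; apply: Lfun2_intro => //.
apply: le_lt_trans (integral_sqr_le mu mY mZ YZ) _.
by have /integrable_lty := Lfun2_integrable_sqr Z2; exact.
Qed.

Lemma variance_mean0 (d : measure_display) (T : measurableType d) (R : realType)
    (P : probability T R) (Y : T -> R) :
  Y \in Lfun P 2%:E -> ('E_P[Y] = 0)%E ->
  ('V_P[Y] = \int[P]_w ((Y w) ^+ 2)%:E)%E.
Proof. by move=> Y2 EY; rewrite varianceE// EY expe2 mule0 sube0 unlock. Qed.

Section uncorrelated.
Context (d : measure_display) (T : measurableType d) (R : realType)
  (P : probability T R).

Lemma integral_cst_probability (c : R) : (\int[P]_w c%:E = c%:E)%E.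
Proof. by have := expectation_cst P c; rewrite unlock. Qed.

Lemma Lfun2_Lfun1 (Y : T -> R) : Y \in Lfun P 2%:E -> Y \in Lfun P 1.
Proof. by apply: Lfun_subset12; exact: fin_num_measure. Qed.

Lemma Lfun2_sum (I : Type) (s : seq I) (Y : I -> T -> R) :
  (forall i, Y i \in Lfun P 2%:E) -> \sum_(i <- s) Y i \in Lfun P 2%:E.
Proof. by move=> Y2; apply: rpred_sum => [|? i _]; rewrite ?lee_fin ?ler1n. Qed.

Lemma expectation_bigsum (I : Type) (s : seq I) (Y : I -> T -> R) :
  (forall i, Y i \in Lfun P 2%:E) ->
  ('E_P[(\sum_(i <- s) Y i)%R] = \sum_(i <- s) 'E_P[Y i])%E.
Proof.
move=> Y2; elim: s => [|a s IHs]; first by rewrite !big_nil expectation_cst.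
by rewrite !big_cons expectationD ?IHs// Lfun2_Lfun1// Lfun2_sum.
Qed.

Lemma covariance_suml (I : Type) (s : seq I) (Y : I -> T -> R) (Z : T -> R) :
  (forall i, Y i \in Lfun P 2%:E) -> Z \in Lfun P 2%:E ->
  (covariance P (\sum_(i <- s) Y i)%R Z = \sum_(i <- s) covariance P (Y i) Z)%E.
Proof.
move=> Y2 Z2; elim: s => [|a s IHs]; first by rewrite !big_nil covariance_cst_l.
by rewrite !big_cons covarianceDl ?IHs// Lfun2_sum.
Qed.

Lemma variance_sum_uncorrelated (I : eqType) (s : seq I) (Y : I -> T -> R) :
  uniq s -> (forall i, Y i \in Lfun P 2%:E) ->
  (forall i j, i != j -> covariance P (Y i) (Y j) = 0%E) ->
  ('V_P[(\sum_(i <- s) Y i)%R] = \sum_(i <- s) 'V_P[Y i])%E.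
Proof.
move=> + Y2 Y0; elim: s => [|a s IHs]; first by rewrite !big_nil variance_cst.
rewrite cons_uniq !big_cons => /andP[a_s /IHs {}IHs].
rewrite varianceD ?Lfun2_sum// IHs covarianceC covariance_suml//.
rewrite [X in (2%:E * X)%E]big1_seq ?mule0 ?adde0// => i /andP[_ i_s].
by apply: Y0; apply: contraNneq a_s => <-.
Qed.

(** Nonnegative functions are covered by [integral_prod_indep], with constant
    factors 1 at the other indices; the general case follows from bilinearity
    of the covariance applied to positive and negative parts. *)
Lemma covariance_indep (I : finType) (X : I -> {RV P >-> R}) (i j : I)
    (f g : R -> R) :
  mutually_independent X -> i != j ->
  measurable_fun setT f -> measurable_fun setT g ->
  f \o X i \in Lfun P 2%:E -> g \o X j \in Lfun P 2%:E ->
  covariance P (f \o X i) (g \o X j) = 0%E.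
Proof.
move=> indX ij.
have mX l : measurable_fun setT (X l) by exact: measurable_funPT.
have nonneg (u v : R -> R) : measurable_fun setT u -> measurable_fun setT v ->
    (forall x, 0 <= u x) -> (forall x, 0 <= v x) ->
    u \o X i \in Lfun P 2%:E -> v \o X j \in Lfun P 2%:E ->
    covariance P (u \o X i) (v \o X j) = 0%E.
  move=> mu mv u0 v0 u2 v2.
  have u1 := Lfun2_Lfun1 u2; have v1 := Lfun2_Lfun1 v2.
  rewrite covarianceE ?Lfun2_mul_Lfun1//.
  have ji : j != i by rewrite eq_sym.
  pose h l := if l == i then u else if l == j then v else cst 1.
  have hi : h i = u by rewrite /h eqxx.
  have hj : h j = v by rewrite /h eqxx (negbTE ji).
  have h1 l : l != i -> l != j -> h l = cst 1.
    by rewrite /h => /negbTE -> /negbTE ->.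
  have := integral_prod_indep (f := h) indX.
  rewrite (bigD1 i)//= (bigD1 j)//= hi hj big1 ?mule1; last first.
    by move=> l /andP[li lj]; rewrite h1//= integral_cst_probability.
  have hprod w : \prod_l h l (X l w) = u (X i w) * v (X j w).
    rewrite (bigD1 i)//= (bigD1 j)//= hi hj big1 ?mulr1// => l /andP[li lj].
    by rewrite h1.
  under eq_integral do rewrite hprod.
  have := expectation_fin_num u1; have := expectation_fin_num v1.
  rewrite unlock => vfin ufin -> //; first by rewrite subee// fin_numM.
  - by move=> l; rewrite /h; case: ifP => // _; case: ifP.
  - by move=> l x; rewrite /h; case: ifP => // _; case: ifP.
  have L1 (Y : T -> R) : Y \in Lfun P 1 ->
      (\int[P]_w (Y w)%:E < +oo)%E.
    by move=> /Lfun1_integrable Y1; exact/integrable_lty.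
  move=> l; have [->|li] := eqVneq l i; first by rewrite hi; apply: L1.
  have [->|lj] := eqVneq l j; first by rewrite hj; apply: L1.
  by rewrite h1//= integral_cst_probability ltry.
move=> mf mg f2 g2.
have pm (u : R -> R) l : measurable_fun setT u -> u \o X l \in Lfun P 2%:E ->
    u^\+ \o X l \in Lfun P 2%:E /\ u^\- \o X l \in Lfun P 2%:E.
  move=> mu u2.
  have muX := measurableT_comp mu (mX l).
  split; apply: (Lfun2_le _ muX u2).
  - exact: (measurableT_comp (measurable_funrpos mu)).
  - move=> w; rewrite /= ger0_norm ?funrpos_ge0// /funrpos ge_max normr_ge0.
    by rewrite ler_norm.
  - exact: (measurableT_comp (measurable_funrneg mu)).
  - move=> w; rewrite /= ger0_norm ?funrneg_ge0// /funrneg ge_max normr_ge0.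
    by rewrite -normrN ler_norm.
have [fp fn] := pm f i mf f2; have [gp gn] := pm g j mg g2.
have split (u : R -> R) l :
    u \o X l = ((u^\+ \o X l) \- (u^\- \o X l))%R.
  by rewrite -[in LHS](funrposBneg u).
rewrite (split f) (split g) covarianceBl// ?rpredB ?lee_fin ?ler1n//.
have mf' := measurable_funrpos mf; have mf'' := measurable_funrneg mf.
have mg' := measurable_funrpos mg; have mg'' := measurable_funrneg mg.
rewrite !covarianceBr// !nonneg ?sube0// => x.
all: by rewrite ?funrpos_ge0 ?funrneg_ge0.
Qed.

End uncorrelated.

(** * Elementary inequalities *)

Section elementary.
Context (R : realType).
Implicit Types x y a b C : R.

(** From [1 - y <= expR (- y)] one gets [expR y <= (1 - y)^-1], and
    [(1 - y) (1 + y + 2 y^2) = 1 + y^2 (1 - 2 y)] is at least 1. *)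
Lemma expR_le_quad y : y <= 2^-1 -> expR y <= 1 + y + 2 * y ^+ 2.
Proof.
move=> y2; have y1 : 0 < 1 - y by lra.
have : (1 - y) * expR y <= 1.
  rewrite -[leRHS](expRxMexpNx_1 y) [leRHS]mulrC ler_wpM2r ?expR_ge0//.
  exact: (expR_ge1Dx (- y)).
rewrite mulrC -ler_pdivlMr// => /le_trans; apply.
rewrite ler_pdivrMr// -subr_ge0.
have -> : (1 + y + 2 * y ^+ 2) * (1 - y) - 1 = y ^+ 2 * (1 - 2 * y) by ring.
by apply: mulr_ge0; [exact: sqr_ge0|lra].
Qed.

(** [24 = 4!] is the denominator of the fourth term of the exponential series. *)
Lemma expr4_le_expR x : x ^+ 4 <= 24 * (expR x + expR (- x)).
Proof.
have nneg y : 0 <= y -> y ^+ 4 <= 24 * expR y.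
  move=> y0; have := expR_ge1Dxn 3 y0.
  rewrite (_ : 4`!%:R = 24)// => h.
  by rewrite mulrC -ler_pdivrMr// (le_trans _ h)// lerDr.
have e0 := expR_ge0.
have [/nneg h|/ltW x0] := leP 0 x.
  by rewrite (le_trans h)// ler_wpM2l// lerDl.
have := nneg (- x); rewrite oppr_ge0 x0 => /(_ isT).
have -> : (- x) ^+ 4 = x ^+ 4 by ring.
by move=> h; rewrite (le_trans h)// ler_wpM2l// lerDr.
Qed.

(** The larger of [a] and [b] in absolute value carries the sum up to a factor
    2.  When this is [a], the hypothesis gives
    [C (a + b)^2 <= (a + b)^4 <= (4 a^2)^2]. *)
Lemma sqrD_le_split a b C : 0 < C -> C < (a + b) ^+ 2 ->
  (a + b) ^+ 2 <= 16 / C * a ^+ 4 + 4 * b ^+ 2.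
Proof.
move=> C0 Cab; have b2 := sqr_ge0 b; have a4 : 0 <= 16 / C * a ^+ 4.
  by rewrite mulr_ge0 ?divr_ge0 ?(ltW C0)// exprn_even_ge0.
have [ab|ba] := leP (b ^+ 2) (a ^+ 2); last first.
  have : 0 <= (a - b) ^+ 2 by exact: sqr_ge0.
  by move: ba a4; set z := 16 / C * _; rewrite !expr2; nra.
suff : (a + b) ^+ 2 <= 16 / C * a ^+ 4.
  by move=> /le_trans; apply; rewrite lerDl; lra.
rewrite mulrAC ler_pdivlMr//.
have ab4 : (a + b) ^+ 2 <= 4 * a ^+ 2.
  have : 0 <= (a - b) ^+ 2 by exact: sqr_ge0.
  by move: ab; rewrite !expr2; nra.
have -> : 16 * a ^+ 4 = (4 * a ^+ 2) * (4 * a ^+ 2) by ring.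
by apply: ler_pM => //; [exact: sqr_ge0|exact: ltW|rewrite (le_trans (ltW Cab))].
Qed.

End elementary.

(** * Moments of sums of independent centred variables *)

Section independent_sums.
Context (d : measure_display) (T : measurableType d) (R : realType)
  (P : probability T R) (I : finType) (X : I -> {RV P >-> R}).
Hypothesis indX : mutually_independent X.
Variable g : I -> R -> R.
Hypothesis mg : forall i, measurable_fun setT (g i).
Hypothesis g2 : forall i, g i \o X i \in Lfun P 2%:E.
Hypothesis Eg : forall i, ('E_P[g i \o X i] = 0)%E.

Lemma integral_sqr_sum_indep :
  (\int[P]_w ((\sum_i g i (X i w)) ^+ 2)%:E =
   \sum_i \int[P]_w ((g i (X i w)) ^+ 2)%:E)%E.
Proof.
have sumE w : \sum_i g i (X i w) = (\sum_i (g i \o X i)) w.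
  by rewrite fct_sumE.
under eq_integral do rewrite sumE.
rewrite -variance_mean0 ?Lfun2_sum//; last first.
  by rewrite expectation_bigsum// big1.
rewrite variance_sum_uncorrelated ?index_enum_uniq// => [|i j ij].
  by apply: eq_bigr => i _; rewrite variance_mean0.
exact: covariance_indep.
Qed.

(** Because the linear term integrates to 0, each factor
    [expR (g i (X i w))] has expectation at most [1 + 2 v i <= expR (2 v i)],
    and expectations of independent factors multiply. *)
Lemma integral_expR_sum_indep (v : I -> R) :
  (forall i x, g i x <= 2^-1) ->
  (forall i, \int[P]_w ((g i (X i w)) ^+ 2)%:E <= (v i)%:E)%E ->
  (\int[P]_w (expR (\sum_i g i (X i w)))%:E <= (expR (2 * \sum_i v i))%:E)%E.
Proof.
move=> g12 gv.
have one i : (\int[P]_w (expR (g i (X i w)))%:E <= (expR (2 * v i))%:E)%E.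
  have g1 := Lfun2_Lfun1 (g2 i).
  have gg1 := Lfun2_mul_Lfun1 (g2 i) (g2 i).
  pose q := cst 1 \+ ((g i \o X i) \+ (2 \o* ((g i \o X i) \* (g i \o X i)))).
  apply: (@le_trans _ _ ('E_P[q])%E).
    rewrite unlock; apply: ge0_le_integral => //.
    - apply/measurable_EFinP; apply: (measurableT_comp (@measurable_expR R)).
      exact: (measurableT_comp (mg i)).
    - have /Lfun1_integrable/integrableP[//] : q \in Lfun P 1.
      by rewrite !rpredD ?Lfun_cst ?Lfun_scale.
    - move=> w _; rewrite lee_fin /q /= (le_trans (expR_le_quad (g12 i _)))//.
      by rewrite expr2 addrA [_ * 2]mulrC.
  rewrite !expectationD ?Lfun_cst ?rpredD ?Lfun_scale//.
  rewrite expectation_cst Eg add0e expectationZl// [in leLHS]unlock.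
  under eq_integral => w _ do rewrite /= -expr2.
  apply: (@le_trans _ _ (1 + 2 * v i)%:E); last by rewrite lee_fin expR_ge1Dx.
  by rewrite [leRHS]EFinD EFinM leeD2l// lee_pmul2l// lte_fin.
have exp0 i : (0 <= \int[P]_w (expR (g i (X i w)))%:E)%E.
  by apply: integral_ge0 => w _; rewrite lee_fin expR_ge0.
under eq_integral do rewrite expR_sum.
rewrite (integral_prod_indep (f := fun i x => expR (g i x)) indX)//; last 2 first.
- by move=> i; apply: (measurableT_comp (@measurable_expR R)).
- by move=> i; rewrite (le_lt_trans (one i))// ltry.
rewrite mulr_sumr expR_sum -prodEFin.
(* Monotonicity of products of extended reals also needs nonnegativity, which is
   carried along in the induction. *)
suff /andP[] : ((0 <= \prod_i \int[P]_w (expR (g i (X i w)))%:E) &&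
  (\prod_i \int[P]_w (expR (g i (X i w)))%:E <= \prod_i (expR (2 * v i))%:E))%E.
  by [].
elim/big_rec2: _ => [|i y z _ /andP[y0 yz]]; first by rewrite lee_fin ler01 lexx.
by rewrite mule_ge0//= lee_pmul.
Qed.

End independent_sums.

(** * Centring and truncation *)

Section centering.
Context (d : measure_display) (T : measurableType d) (R : realType)
  (P : probability T R).
Implicit Types Y : T -> R.

Lemma expectation_centered Y : Y \in Lfun P 2%:E ->
  ('E_P[Y \- cst (fine 'E_P[Y])] = 0)%E.
Proof.
move=> Y2; have Y1 := Lfun2_Lfun1 Y2.
have EY := expectation_fin_num Y1.
by rewrite expectationB ?Lfun_cst// expectation_cst fineK ?subee.
Qed.

Lemma Lfun2_centered Y : Y \in Lfun P 2%:E ->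
  (Y \- cst (fine 'E_P[Y]))%R \in Lfun P 2%:E.
Proof.
move=> Y2; apply: rpredB => [|?|?]; rewrite ?lee_fin ?ler1n//.
exact: Lfun_cst.
Qed.

(** The variance is the second moment minus the square of the mean. *)
Lemma integral_sqr_centered_le Y : Y \in Lfun P 2%:E ->
  (\int[P]_w ((Y w - fine 'E_P[Y]) ^+ 2)%:E <= \int[P]_w ((Y w) ^+ 2)%:E)%E.
Proof.
move=> Y2; have := varianceE Y2; rewrite /variance covariance.unlock => VE.
have -> : (\int[P]_w ((Y w - fine 'E_P[Y]) ^+ 2)%:E =
   'E_P[((Y \- cst (fine 'E_P[Y])) * (Y \- cst (fine 'E_P[Y])))%R])%E.
  set m := fine _; rewrite unlock.
  by apply: eq_integral => w _; rewrite expr2.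
rewrite VE leeBlDr; last first.
  by rewrite fin_numX// expectation_fin_num// Lfun2_Lfun1.
have -> : (\int[P]_w ((Y w) ^+ 2)%:E = 'E_P[(Y ^+ 2)%R])%E by rewrite unlock.
by rewrite leeDl// sqre_ge0.
Qed.

Lemma norm_expectation_le Y (s : R) : Y \in Lfun P 2%:E ->
  (forall w, `|Y w| <= s) -> `|fine 'E_P[Y]| <= s.
Proof.
move=> Y2 Ys; have Y1 := Lfun2_Lfun1 Y2.
have EY := expectation_fin_num Y1.
rewrite -lee_fin -fine_abse// fineK ?abse_fin_num//.
have /Lfun1_integrable/integrableP[mY _] := Y1.
rewrite unlock (le_trans (le_abse_integral _ _ _))//.
rewrite -[leRHS](integral_cst_probability P).
apply: ge0_le_integral => //; first exact: measurableT_comp.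
by move=> w _; rewrite lee_fin.
Qed.

End centering.

Section truncation.
Context (R : realType).
Implicit Types s x : R.

Definition trunc s x := if `|x| <= s then x else 0.

Lemma measurable_trunc s : measurable_fun setT (trunc s).
Proof.
by apply: measurable_fun_ifT => //; exact: measurable_fun_ler.
Qed.

Lemma norm_trunc_le s x : 0 <= s -> `|trunc s x| <= s.
Proof. by move=> s0; rewrite /trunc; case: ifPn => //; rewrite normr0. Qed.

Lemma norm_trunc_le_id s x : `|trunc s x| <= `|x|.
Proof. by rewrite /trunc; case: ifP => //; rewrite normr0. Qed.

Lemma norm_truncC_le_id s x : `|x - trunc s x| <= `|x|.
Proof. by rewrite /trunc; case: ifP => _; rewrite ?subrr ?subr0 ?normr0. Qed.

Lemma integral_sqr_truncC (d : measure_display) (T : measurableType d)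
    (mu : {measure set T -> \bar R}) (Y : T -> R) s :
  (\int[mu]_w ((Y w - trunc s (Y w)) ^+ 2)%:E =
   \int[mu]_(w in [set w | (s < `|Y w|)%R]) ((Y w) ^+ 2)%:E)%E.
Proof.
rewrite [RHS]integral_mkcond; apply: eq_integral => w _; rewrite patchE /trunc.
case: (boolP (w \in _)) => [/set_mem /=|/negP ws].
  by rewrite ltNge => /negbTE ->; rewrite subr0.
have -> : `|Y w| <= s by rewrite leNgt; apply/negP => /mem_set.
by rewrite subrr expr0n.
Qed.

End truncation.

(** * The tail of a normed row *)

Lemma measurable_tail_set (d : measure_display) (T : measurableType d)
    (R : realType) (f : T -> R) (C : R) :
  measurable_fun setT f -> measurable [set w | (C < `|f w|)%R].
Proof.
move=> mf.
have mnf : measurable_fun setT (Num.norm \o f) by exact: measurableT_comp.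
have -> : [set w | C < `|f w|] = setT `&` (Num.norm \o f) @^-1` `]C, +oo[%classic.
  by apply/seteqP; split => w /=; rewrite in_itv/= andbT// => -[].
by apply: mnf => //; exact: measurable_itv.
Qed.

Section row_tail.
Context (d : measure_display) (T : measurableType d) (R : realType)
  (P : probability T R) (I : finType) (X : I -> {RV P >-> R}) (v : R).
Hypothesis indX : mutually_independent X.
Hypothesis EX : forall i, ('E_P[X i] = 0)%E.
Hypothesis X2 : forall i, (X i : T -> R) \in Lfun P 2%:E.
Hypothesis v_gt0 : 0 < v.
Hypothesis vE : (\sum_i \int[P]_w ((X i w) ^+ 2)%:E = v%:E)%E.

Let s := Num.sqrt v.
Let u := trunc s.
Let uC x := x - u x.
(* [m i] is the mean of the truncated variable, and [- m i] that of the
   remainder [uC], because [X i] has mean 0 ([m_uC]). *)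
Let m i := fine 'E_P[u \o X i].
Let lo i x := u x - m i.
Let hi i x := uC x + m i.

Let s_gt0 : 0 < s. Proof. by rewrite sqrtr_gt0. Qed.
Let s2 : s ^+ 2 = v. Proof. by rewrite sqr_sqrtr// ltW. Qed.

Let mX i : measurable_fun setT (X i). Proof. exact: measurable_funPT. Qed.
Let mu : measurable_fun setT u. Proof. exact: measurable_trunc. Qed.

Let u2 i : u \o X i \in Lfun P 2%:E.
Proof.
apply: (Lfun2_le _ (mX i) (X2 i)); first exact: measurableT_comp.
by move=> w; exact: norm_trunc_le_id.
Qed.

Let uC2 i : uC \o X i \in Lfun P 2%:E.
Proof.
apply: (Lfun2_le _ (mX i) (X2 i)); last by move=> w; exact: norm_truncC_le_id.
by apply: measurable_funB => //; exact: measurableT_comp.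
Qed.

Let muC : measurable_fun setT uC. Proof. exact: measurable_funB. Qed.

Let m_uC i : fine ('E_P[uC \o X i])%E = - m i.
Proof.
have -> : uC \o X i = (X i : T -> R) \- (u \o X i) by [].
by rewrite expectationB ?Lfun2_Lfun1// EX sub0e fineN.
Qed.

Let mlo i : measurable_fun setT (lo i).
Proof. by apply: measurable_funB => //; exact: measurable_cst. Qed.

Let mhi i : measurable_fun setT (hi i).
Proof.
by apply: measurable_funD => //; exact: measurable_cst.
Qed.

Let loE i : lo i \o X i = (u \o X i) \- cst (fine 'E_P[u \o X i]).
Proof. by []. Qed.

Let hiE i : hi i \o X i = (uC \o X i) \- cst (fine 'E_P[uC \o X i]).
Proof. by apply/funext => w; rewrite /= m_uC opprK. Qed.

Let S w := \sum_i X i w.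
Let A w := \sum_i lo i (X i w).
Let B w := \sum_i hi i (X i w).

Let SE w : S w = A w + B w.
Proof.
rewrite -big_split/=; apply: eq_bigr => i _.
by rewrite /lo /hi /uC; ring.
Qed.

Let integral_B2 : (\int[P]_w ((B w) ^+ 2)%:E <=
  \sum_i \int[P]_(w in [set w | (s < `|X i w|)%R]) ((X i w) ^+ 2)%:E)%E.
Proof.
rewrite (integral_sqr_sum_indep indX mhi); first last.
- by move=> i; rewrite hiE expectation_centered.
- by move=> i; rewrite hiE Lfun2_centered.
apply: lee_sum => i _; rewrite -integral_sqr_truncC.
apply: le_trans (integral_sqr_centered_le (uC2 i)).
rewrite m_uC le_eqVlt; apply/orP; left; apply/eqP/eq_integral => w _.
by rewrite opprK.
Qed.

(* The scale [4 s] makes the exponents at most [2 s / (4 s) = 1 / 2] in absolute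
   value.  The second moments of the scaled variables add up to at most
   [v / (4 s)^2 = 1 / 16], whence the bound [expR (1 / 8)]. *)
Let integral_expA (e : R) : `|e| = (4 * s)^-1 ->
  (\int[P]_w (expR (e * A w))%:E <= 2%:E)%E.
Proof.
move=> es.
have e2 : e ^+ 2 = (16 * v)^-1.
  by rewrite -real_normK ?num_real// es exprVn exprMn s2; congr (_ * _)^-1; ring.
pose t i := fine (\int[P]_w ((X i w) ^+ 2)%:E).
have tE i : (\int[P]_w ((X i w) ^+ 2)%:E = (t i)%:E)%E.
  rewrite fineK// ge0_fin_numE; last first.
    by apply: integral_ge0 => w _; rewrite lee_fin sqr_ge0.
  by have /integrable_lty := Lfun2_integrable_sqr (X2 i); exact.
have tv : \sum_i t i = v.
  by apply: EFin_inj; rewrite -sumEFin -vE; apply: eq_bigr.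
have mg i : measurable_fun setT (fun x => e * lo i x).
  by apply: measurable_funM => //; exact: measurable_cst.
have gE i : (fun x => e * lo i x) \o X i = e \o* (lo i \o X i).
  by apply/funext => w /=; rewrite mulrC.
have lo2 i : lo i \o X i \in Lfun P 2%:E by rewrite loE Lfun2_centered.
pose vt i := e ^+ 2 * t i.
have := @integral_expR_sum_indep _ _ _ P I X indX _ mg _ _ vt.
rewrite [in \sum_i vt i]/vt -mulr_sumr tv.
under eq_integral do rewrite -mulr_sumr.
move=> h; apply: (le_trans (h _ _ _ _)).
- by move=> i; rewrite gE Lfun_scale// ler1n.
- move=> i; rewrite gE expectationZl ?Lfun2_Lfun1//.
  by rewrite loE expectation_centered// mule0.
- move=> i x; rewrite (le_trans (ler_norm _))// normrM es.
  rewrite mulrC ler_pdivrMr ?mulr_gt0// (le_trans (ler_normB _ _))//.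
  have := norm_trunc_le x (ltW s_gt0).
  have := norm_expectation_le (u2 i) (fun w => norm_trunc_le (X i w) (ltW s_gt0)).
  by rewrite -/u -/(m i); lra.
- move=> i; rewrite EFinM -tE.
  under eq_integral do rewrite exprMn EFinM.
  rewrite ge0_integralZl_EFin ?sqr_ge0//; last 2 first.
  + by move=> w _; rewrite lee_fin sqr_ge0.
  + apply/measurable_EFinP; apply: measurable_funX.
    exact: (measurableT_comp (mlo i)).
  apply: lee_pmul => //.
  + by rewrite lee_fin sqr_ge0.
  + by apply: integral_ge0 => w _; rewrite lee_fin sqr_ge0.
  apply: (le_trans (integral_sqr_centered_le (u2 i))).
  apply: integral_sqr_le => // [|w]; first exact: measurableT_comp.
  exact: norm_trunc_le_id.
rewrite lee_fin e2.
have -> : 2 * ((16 * v)^-1 * v) = 8^-1 by field; rewrite gt_eqF.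
apply: (le_trans (expR_le_quad _)); lra.
Qed.

(** In the constant, [16] comes from [sqrD_le_split], [4 ^+ 4] from the scale of
    the exponential moments, [24] from [expr4_le_expR], and the last [4] bounds
    the sum of the two exponential moments. *)
Lemma integral_tail_sqr_sum_indep (C : R) : 0 < C ->
  (\int[P]_(w in [set w | (C < `|(\sum_i X i w) ^+ 2 / v|)%R])
     (`|(\sum_i X i w) ^+ 2 / v|)%:E <=
   (16 * 4 ^+ 4 * 24 * 4 / C)%:E + 4%:E * ((v^-1)%:E *
     \sum_i \int[P]_(w in [set w | (s < `|X i w|)%R]) ((X i w) ^+ 2)%:E))%E.
Proof.
move=> C0.
pose e := (4 * s)^-1.
pose Ep w := expR (e * A w); pose Em w := expR (- e * A w).
pose K := 16 * 4 ^+ 4 * 24 / C.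
have e_gt0 : 0 < e by rewrite invr_gt0 mulr_gt0.
have K_ge0 : 0 <= K by rewrite divr_ge0 ?(ltW C0)// !mulr_ge0// exprn_ge0.
have mA : measurable_fun setT A.
  by apply: measurable_sum => i; exact: (measurableT_comp (mlo i)).
have mB : measurable_fun setT B.
  by apply: measurable_sum => i; exact: (measurableT_comp (mhi i)).
have mS : measurable_fun setT S by apply: measurable_sum.
have mexp c : measurable_fun setT (fun w => expR (c * A w)).
  apply: (measurableT_comp (@measurable_expR R)).
  exact: (measurable_funM (measurable_cst c) mA).
have pointwise w : C < S w ^+ 2 / v ->
    S w ^+ 2 / v <= K * (Ep w + Em w) + 4 / v * B w ^+ 2.
  have -> : S w ^+ 2 / v = (A w / s + B w / s) ^+ 2.
    by rewrite SE -s2 -mulrDl exprMn exprVn.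
  move=> /(sqrD_le_split C0) /le_trans; apply; apply: lerD; last first.
    by rewrite exprMn exprVn s2 le_eqVlt; apply/orP; left; apply/eqP; ring.
  (* The fourth power is estimated at the scale [e] of the exponential moments,
     whence the factor [4 ^+ 4]. *)
  have := expr4_le_expR (e * A w); rewrite -mulNr -/(Ep w) -/(Em w).
  have -> : (e * A w) ^+ 4 = (A w / s) ^+ 4 / 4 ^+ 4.
    by rewrite /e; field; rewrite gt_eqF.
  rewrite ler_pdivrMr// => h.
  rewrite /K; apply: (le_trans (ler_wpM2l _ h)); first by rewrite divr_ge0// ltW.
  by rewrite le_eqVlt; apply/orP; left; apply/eqP; field; rewrite gt_eqF.
have S0 w : 0 <= S w ^+ 2 / v by rewrite divr_ge0 ?sqr_ge0// ltW.
have Epm0 w : 0 <= Ep w + Em w by apply: addr_ge0; exact: expR_ge0.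
have E0 w : 0 <= K * (Ep w + Em w) by exact: mulr_ge0.
have v4_ge0 : 0 <= 4 / v by rewrite divr_ge0// ltW.
have B0 w : 0 <= 4 / v * B w ^+ 2 by rewrite mulr_ge0// sqr_ge0.
have mSv : measurable_fun setT (fun w => S w ^+ 2 / v).
  exact: (measurable_funM (measurable_funX 2 mS) (measurable_cst _)).
have mEpm : measurable_fun setT (fun w => Ep w + Em w).
  exact: (measurable_funD (mexp _) (mexp _)).
have mB2 : measurable_fun setT (fun w => B w ^+ 2) by apply: measurable_funX.
apply: (@le_trans _ _
  (\int[P]_w (K%:E * (Ep w + Em w)%:E + (4 / v)%:E * (B w ^+ 2)%:E))%E).
  rewrite integral_mkcond; apply: ge0_le_integral => //.
  - by move=> w _; apply: erestrict_ge0 => ? _; rewrite lee_fin.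
  - apply/(measurable_restrictT _ (measurable_tail_set C mSv)).1.
    by apply: measurable_funTS; apply/measurable_EFinP; exact: measurableT_comp.
  - by apply: emeasurable_funD; apply: measurable_funeM; exact/measurable_EFinP.
  - move=> w _; rewrite patchE -!EFinM -EFinD; case: ifPn => [/set_mem /=|_].
      by rewrite -/(S w) ger0_norm// => Cw; rewrite lee_fin pointwise.
    by rewrite lee_fin addr_ge0.
rewrite ge0_integralD//; last 4 first.
- by move=> w _; rewrite -EFinM lee_fin.
- by apply: measurable_funeM; exact/measurable_EFinP.
- by move=> w _; rewrite -EFinM lee_fin.
- by apply: measurable_funeM; exact/measurable_EFinP.
apply: leeD.
  rewrite ge0_integralZl_EFin//; last 2 first.
  - by move=> w _; rewrite lee_fin.
  - exact/measurable_EFinP.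
  under eq_integral do rewrite EFinD.
  rewrite ge0_integralD//; last 4 first.
  - by move=> w _; rewrite lee_fin expR_ge0.
  - by apply/measurable_EFinP; exact: mexp.
  - by move=> w _; rewrite lee_fin expR_ge0.
  - by apply/measurable_EFinP; exact: mexp.
  have -> : (16 * 4 ^+ 4 * 24 * 4 / C)%:E = (K%:E * (2%:E + 2%:E))%E.
    by rewrite -EFinD -EFinM; congr EFin; rewrite /K; field; rewrite gt_eqF.
  apply: lee_pmul => //.
    by apply: adde_ge0; apply: integral_ge0 => w _; rewrite lee_fin expR_ge0.
  by apply: leeD; apply: integral_expA; rewrite ?normrN gtr0_norm.
rewrite ge0_integralZl_EFin//; last 2 first.
- by move=> w _; rewrite lee_fin sqr_ge0.
- exact/measurable_EFinP.
rewrite EFinM -muleA; apply: lee_pmul => //.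
  apply: mule_ge0; first by rewrite lee_fin invr_ge0 ltW.
  by apply: integral_ge0 => w _; rewrite lee_fin sqr_ge0.
apply: lee_pmul => //; first by rewrite lee_fin invr_ge0 ltW.
by apply: integral_ge0 => w _; rewrite lee_fin sqr_ge0.
Qed.

End row_tail.

(** * Uniform integrability *)

Section ereal_limit_to_zero.
Context (R : realType) (I : Type) (F : set_system I) (FF : Filter F).
Implicit Type f : I -> \bar R.
Local Open Scope ereal_scope.

Lemma cvge0_near_lt f (e : R) :
  f x @[x --> F] --> 0 -> (0 < e)%R -> \forall x \near F, f x < e%:E.
Proof.
move=> f0 e0; apply: (f0 [set y | y < e%:E]).
by apply: open_nbhs_nbhs; split; [exact: open_ereal_lt_ereal|rewrite /= lte_fin].
Qed.

Lemma cvge0_near_le f :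
  (forall e : R, (0 < e)%R -> \forall x \near F, 0 <= f x <= e%:E) ->
  f x @[x --> F] --> 0.
Proof.
move=> fe; apply/fine_cvgP; split.
  apply: filterS (fe 1%R ltr01) => x /andP[f0 f1].
  by rewrite ge0_fin_numE// (le_lt_trans f1)// ltry.
apply/cvgrPdist_le => e e0; apply: filterS (fe e e0) => x /andP[f0 f1].
have ffin : f x \is a fin_num by rewrite ge0_fin_numE// (le_lt_trans f1)// ltry.
rewrite /= sub0r normrN ger0_norm ?fine_ge0//.
by rewrite -lee_fin fineK.
Qed.

End ereal_limit_to_zero.

(** Dominated convergence along integer thresholds; the tail integral is
    nonincreasing in the threshold. *)
Lemma integrable_tail_near (d : measure_display) (T : measurableType d)
    (R : realType) (mu : {measure set T -> \bar R}) (f : T -> R) (e : R) :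
  mu.-integrable setT (EFin \o f) -> 0 < e ->
  \forall C \near +oo,
    (\int[mu]_(w in [set w | (C < `|f w|)%R]) (`|f w|)%:E <= e%:E)%E.
Proof.
move=> fint e0; have /measurable_int/measurable_EFinP mf := fint.
pose D (C : R) := [set w | C < `|f w|].
have mD C : measurable (D C) by exact: measurable_tail_set.
have mnf : measurable_fun setT (fun w => (`|f w|)%:E).
  by apply/measurable_EFinP; exact: measurableT_comp.
pose g n := (fun w => (`|f w|)%:E) \_ (D n%:R).
have [|||||_ _] := @dominated_convergence _ _ _ mu setT measurableT g (cst 0%E)
    (fun w => (`|f w|)%:E).
- by move=> n; apply/(measurable_restrictT _ (mD _)).1; exact: measurable_funTS.
- exact: measurable_cst.
- apply: aeW => w _; apply: cvg_near_cst.
  near=> n; rewrite /g patchE memNset//=; apply/negP; rewrite -leNgt.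
  by near: n; exact: nbhs_infty_ger.
- exact: integrable_abse fint.
- apply: aeW => w n _; rewrite /g patchE; case: ifP => _.
    by rewrite abse_EFin normr_id.
  by rewrite abse0 lee_fin.
rewrite integral0 => h.
have [N _ hN] := cvge0_near_lt h e0.
near=> C.
apply: le_trans (ltW (hN N _)) => //=.
rewrite /g -integral_mkcond.
apply: (@ge0_subset_integral _ _ _ mu _ _ (mD _) (mD _)) => //.
- exact: measurable_funTS.
move=> w /=; apply: le_lt_trans; near: C; exact: nbhs_pinfty_ge.
Unshelve. all: by end_near. Qed.

Section row.
Context (d : measure_display) (T : measurableType d) (R : realType)
  (P : probability T R) (k : nat -> nat)
  (xi : forall n : nat, 'I_(k n) -> {RV P >-> R}) (n : nat).
Arguments xi : clear implicits.
Hypothesis indep : mutually_independent (xi n).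
Hypothesis mean0 : forall j : 'I_(k n), ('E_P[xi n j] = 0)%E.
Hypothesis sq : forall j : 'I_(k n), ('E_P[fun w => (xi n j w ^+ 2)%R] < +oo)%E.

Lemma row_Lfun2 j : (xi n j : T -> R) \in Lfun P 2%:E.
Proof.
apply: Lfun2_intro; first exact: measurable_funPT.
by have := sq j; rewrite unlock.
Qed.

Lemma row_sumE : row_sum xi n = \sum_j (xi n j : T -> R).
Proof. by apply/funext => w; rewrite fct_sumE. Qed.

Lemma row_sum_Lfun2 : row_sum xi n \in Lfun P 2%:E.
Proof. by rewrite row_sumE Lfun2_sum// => j; exact: row_Lfun2. Qed.

Lemma row_varE : (\sum_j \int[P]_w ((xi n j w) ^+ 2)%:E = (row_var xi n)%:E)%E.
Proof.
rewrite fineK ?variance_fin_num ?row_sum_Lfun2//.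
rewrite variance_mean0 ?row_sum_Lfun2//; last first.
  by rewrite row_sumE expectation_bigsum ?big1// => j; exact: row_Lfun2.
apply/esym.
apply: (@integral_sqr_sum_indep _ _ _ P _ (xi n) indep (fun _ x => x)) => //.
by move=> j; exact: row_Lfun2.
Qed.

End row.

Theorem proposition2 (d : measure_display) (T : measurableType d)
    (R : realType) (P : probability T R)
    (k : nat -> nat) (xi : forall n : nat, 'I_(k n) -> {RV P >-> R})
    (k_gt0 : forall n : nat, (1 <= n)%N -> (0 < k n)%N)
    (k_oo : k n @[n --> \oo] --> \oo)
    (xi_indep : forall n : nat, (1 <= n)%N -> mutually_independent (xi n))
    (xi_mean0 : forall (n : nat) (j : 'I_(k n)), (1 <= n)%N ->
       ('E_P[xi n j] = 0)%E)
    (xi_sq : forall (n : nat) (j : 'I_(k n)), (1 <= n)%N ->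
       ('E_P[fun w => (xi n j w ^+ 2)%R] < +oo)%E)
    (var_gt0 : forall n : nat, (1 <= n)%N -> 0 < row_var xi n)
    (xi_lindeberg : lindeberg xi) :
  uniformly_integrable P [set n : nat | (1 <= n)%N]
    (fun n w => row_sum xi n w ^+ 2 / row_var xi n).
Proof.
apply: cvge0_near_le => e e0.
pose tail n (C : R) := (\int[P]_(w in
  [set w | (C < `|row_sum xi n w ^+ 2 / row_var xi n|)%R])
  (`|row_sum xi n w ^+ 2 / row_var xi n|)%:E)%E.
have tail0 n C : (0 <= tail n C)%E.
  by apply: integral_ge0 => w _; rewrite lee_fin.
have [N _ linN] := cvge0_near_lt (xi_lindeberg 1 ltr01) (divr_gt0 e0 (ltr0n _ 8)).
(* Below [N] there are finitely many rows, each with an integrable square. *)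
have small : \forall C \near +oo, forall n : 'I_N,
    (1 <= n)%N -> (tail n C <= e%:E)%E.
  apply: filter_forall => n.
  have [n0|n0] := leqP n 0; first by apply: nearW.
  have : \forall C \near +oo, (tail n C <= e%:E)%E.
    apply: integrable_tail_near => //.
    have S2 := row_sum_Lfun2 (fun j => xi_sq n j n0).
    have := integrableZl measurableT (row_var xi n)^-1 (Lfun2_integrable_sqr S2).
    apply: eq_integrable => // w _; rewrite /= -EFinM mulrC//.
  by apply: filterS => C + _.
pose K : R := 16 * 4 ^+ 4 * 24 * 4.
near=> C.
have C0 : 0 < C by near: C; exact: nbhs_pinfty_gt.
have KC : K / C <= e / 2.
  have : K / (e / 2) <= C by near: C; apply: nbhs_pinfty_ge; rewrite num_real.
  by rewrite !ler_pdivrMr ?divr_gt0// mulrC.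
have small_C : forall n : 'I_N, (1 <= n)%N -> (tail n C <= e%:E)%E by near: C.
apply/andP; split.
  by apply: (le_trans (tail0 1%N C)); apply: ereal_sup_ubound; exists 1%N.
apply: ub_ereal_sup => _ [n /= n1 <-]; rewrite -/(tail n C).
have [nN|Nn] := ltnP n N; first exact: (small_C (Ordinal nN)).
have indep := xi_indep n n1.
have mean0 j := xi_mean0 n j n1.
have sq j := xi_sq n j n1.
apply: le_trans (integral_tail_sqr_sum_indep indep mean0 (row_Lfun2 sq)
  (var_gt0 n n1) (row_varE indep mean0 sq) C0) _.
(* The threshold 1 of the Lindeberg condition is the truncation level [s]. *)
have := linN _ Nn; rewrite /= mul1r => /ltW lin.
rewrite (_ : e%:E = (e / 2)%:E + 4%:E * (e / 8)%:E)%E; last first.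
  by rewrite -EFinM -EFinD; congr EFin; field.
by apply: leeD; rewrite ?lee_fin// lee_pmul2l.
Unshelve. all: by end_near. Qed.
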